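(* Let $\langle G,\mathbf{V},\mathcal{M}\rangle$ be an identifiability tuple, i.e. $G$ is a causal graph, $\mathbf{V}$ its set of observed variables, and $\mathcal{M}$ a set of models of $G$. Let $\mathbf{X},\mathbf{Y}$ be sets of treatment and outcome variables with instantiations $\mathbf{x},\mathbf{y}$. The causal effect $\Pr_{\mathbf{x}}(\mathbf{y})$ is identifiable with respect to $\langle G,\mathbf{V},\mathcal{M}\rangle$ if and only if there is an arithmetic circuit for $\Pr_{\mathbf{x}}(\mathbf{y})$ whose output expression is $\langle G,\mathbf{V},\mathcal{M}\rangle$-invariant.
   Context: Causal graphs and models. A causal graph $G$ is a DAG over discrete variables, each with a fixed, known finite set of states; a subset $\mathbf{V}$ of the variables is observed and the remaining variables are hidden. A model of $G$ is a full parameterization: parameters $\theta_{w|\mathbf{p}}\in[0,1]$ for every variable $W$ with parents $\mathbf{P}$, every state $w$ and parent instantiation $\mathbf{p}$, with $\sum_w\theta_{w|\mathbf{p}}=1$. A model induces a distribution $\Pr$ over all variables as the product of parameters; $\Pr(\mathbf{V})$ is its marginal on $\mathbf{V}$. The causal effect $\Pr_{\mathbf{x}}(\mathbf{y})$ is the probability of $\mathbf{y}$ under the intervention $do(\mathbf{x})$: the sum, over all full instantiations compatible with $\mathbf{x},\mathbf{y}$, of the product of the parameters of all variables not in $\mathbf{X}$. Identifiability. $\Pr_{\mathbf{x}}(\mathbf{y})$ is identifiable with respect to $\langle G,\mathbf{V},\mathcal{M}\rangle$ if $\Pr^1_{\mathbf{x}}(\mathbf{y})=\Pr^2_{\mathbf{x}}(\mathbf{y})$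 for any two models $M^1,M^2\in\mathcal{M}$ whose induced distributions satisfy $\Pr^1(\mathbf{V})=\Pr^2(\mathbf{V})$. Arithmetic circuits. An arithmetic circuit (AC) is a rooted DAG whose internal nodes are labeled $+$ or $\times$ and whose leaves are constants or parameters $\theta_{w|\mathbf{p}}$. Each node specifies an expression, obtained by bottom-up evaluation; the output expression is that of the root. Under a model, each parameter leaf takes its value from the model. An AC for $\Pr_{\mathbf{x}}(\mathbf{y})$ is one whose output evaluates to $\Pr_{\mathbf{x}}(\mathbf{y})$ under every model in $\mathcal{M}$. Invariance. An expression is $\langle G,\mathbf{V},\mathcal{M}\rangle$-invariant if it evaluates to the same value for all models in $\mathcal{M}$ that induce a same $\Pr(\mathbf{V})$. *)

(* Defs.v *)
From mathcomp Require Import all_boot all_order all_algebra.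
From mathcomp Require Import classical_sets reals.

Set Implicit Arguments.
Unset Strict Implicit.
Unset Printing Implicit Defensive.

Import Order.TTheory GRing.Theory Num.Theory.
Local Open Scope ring_scope.

Definition acyclic (T : finType) (e : rel T) : Prop :=
  forall c : seq T, cycle e c -> c = [::].

(* [edge u v] reads [u -> v]. *)
Record causal_graph := CausalGraph {
  var : finType;
  edge : rel var;
  edge_acyclic : acyclic edge;
  state : var -> finType }.

Definition pa (G : causal_graph) (w : var G) : {set var G} :=
  [set u | edge u w].

Definition full_inst (G : causal_graph) : Type :=
  {dffun forall v : var G, state v}.

Definition inst (G : causal_graph) (A : {set var G}) : Type :=
  {dffun forall u : {u : var G | u \in A}, state (val u)}.

Definition restr (G : causal_graph) (A : {set var G}) (z : full_inst G) :
    inst A :=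
  finfun (fun u : {u : var G | u \in A} => z (val u)).

(* [theta m p s] is the parameter of the state [s] of [w] given the
   instantiation [p] of the parents of [w]. *)
Record model (R : realType) (G : causal_graph) := Model {
  theta : forall w : var G, inst (pa w) -> state w -> R;
  theta_itv : forall (w : var G) (p : inst (pa w)) (s : state w),
    0 <= theta p s <= 1;
  theta_sum1 : forall (w : var G) (p : inst (pa w)),
    \sum_(s : state w) theta p s = 1 }.

Section Distributions.
Variables (R : realType) (G : causal_graph).
Implicit Types (m : model R G) (V X Y : {set var G}).

Definition joint m (z : full_inst G) : R :=
  \prod_(w : var G) theta m (restr (pa w) z) (z w).

Definition marginal m V (v : inst V) : R :=
  \sum_(z : full_inst G | restr V z == v) joint m z.

Definition same_marginal V m1 m2 : Prop :=
  forall v : inst V, marginal m1 v = marginal m2 v.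

Definition causal_effect m X Y (x : inst X) (y : inst Y) : R :=
  \sum_(z : full_inst G | (restr X z == x) && (restr Y z == y))
    \prod_(w : var G | w \notin X) theta m (restr (pa w) z) (z w).

Definition identifiable V (M : set (model R G)) X Y
    (x : inst X) (y : inst Y) : Prop :=
  forall m1 m2, M m1 -> M m2 -> same_marginal V m1 m2 ->
    causal_effect m1 x y = causal_effect m2 x y.

End Distributions.

Inductive expr (R : realType) (G : causal_graph) :=
| EConst of R
| EParam (w : var G) of inst (pa w) & state w
| ESum of seq (expr R G)
| EProd of seq (expr R G).

Arguments EConst {R G} _.
Arguments EParam {R G w} _ _.

Fixpoint eval (R : realType) (G : causal_graph) (m : model R G)
    (e : expr R G) : R :=
  match e with
  | EConst c => c
  | EParam w p s => theta m p s
  | ESum es => \sum_(a <- map (eval m) es) a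
  | EProd es => \prod_(a <- map (eval m) es) a
  end.

Definition expr_invariant (R : realType) (G : causal_graph)
    (V : {set var G}) (M : set (model R G)) (e : expr R G) : Prop :=
  forall m1 m2, M m1 -> M m2 -> same_marginal V m1 m2 ->
    eval m1 e = eval m2 e.

Inductive label (R : realType) (G : causal_graph) :=
| LAdd
| LMul
| LConst of R
| LParam (w : var G) of inst (pa w) & state w.

Arguments LAdd {R G}.
Arguments LMul {R G}.
Arguments LConst {R G} _.
Arguments LParam {R G w} _ _.

Definition is_op (R : realType) (G : causal_graph) (l : label R G) : bool :=
  match l with LAdd | LMul => true | _ => false end.

(* Edges go from a node to its children. Distinct nodes may carry the same
   label. *)
Record circuit (R : realType) (G : causal_graph) := Circuit {
  node : finType;
  child : rel node;
  child_acyclic : acyclic child;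
  root : node;
  root_connect : forall n : node, connect child root n;
  node_label : node -> label R G;
  node_internal : forall n : node,
    [exists n' : node, child n n'] = is_op (node_label n) }.

Section NodeExpression.
Variables (R : realType) (G : causal_graph) (A : circuit R G).

(* Recursion along the edges is bounded by the fuel [k]; by acyclicity the
   number of nodes is enough fuel, so that the default value is never reached:
   see [node_exprE]. *)
Fixpoint node_expr_rec (k : nat) (n : node A) : expr R G :=
  if k isn't k'.+1 then EConst 0 else
  match node_label n with
  | LAdd => ESum [seq node_expr_rec k' n' | n' <- enum (child n)]
  | LMul => EProd [seq node_expr_rec k' n' | n' <- enum (child n)]
  | LConst c => EConst c
  | LParam w p s => EParam p s
  end.

Definition node_expr : node A -> expr R G := node_expr_rec #|node A|.

Lemma child_connect_proper (n n' : node A) :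
  child n n' -> (#|connect (@child R G A) n'| < #|connect (@child R G A) n|)%N.
Proof.
move=> nn'; apply/proper_card/properP; split.
  apply/fintype.subsetP => u; rewrite -!topredE /= => n'u.
  exact: connect_trans (connect1 nn') n'u.
exists n; rewrite -topredE /= ?connect0 //.
apply/negP => /connectP[p pp ep].
have : cycle (@child R G A) (n' :: p) by rewrite /= rcons_path pp -ep nn'.
by move/(@child_acyclic R G A).
Qed.

Lemma node_expr_rec_fuel (k k' : nat) (n : node A) :
  (#|connect (@child R G A) n| <= k)%N ->
  (#|connect (@child R G A) n| <= k')%N ->
  node_expr_rec k n = node_expr_rec k' n.
Proof.
have pos u : (0 < #|connect (@child R G A) u|)%N.
  by apply/card_gt0P; exists u; rewrite -topredE /= connect0.
elim: k k' n => [|k IHk] [|k'] n; rewrite ?leqn0 => hk hk'.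
- by [].
- by move: (pos n); rewrite (eqP hk).
- by move: (pos n); rewrite (eqP hk').
have E : [seq node_expr_rec k n' | n' <- enum (child n)] =
         [seq node_expr_rec k' n' | n' <- enum (child n)].
  apply/eq_in_map => u; rewrite mem_enum => /child_connect_proper lt.
  by apply: IHk; rewrite -ltnS; apply: leq_trans lt _.
by rewrite /= E.
Qed.

Lemma node_exprE (n : node A) :
  node_expr n =
  match node_label n with
  | LAdd => ESum [seq node_expr n' | n' <- enum (child n)]
  | LMul => EProd [seq node_expr n' | n' <- enum (child n)]
  | LConst c => EConst c
  | LParam w p s => EParam p s
  end.
Proof.
have -> : node_expr n = node_expr_rec #|node A|.+1 n.
  by apply: node_expr_rec_fuel; rewrite ?leqW ?max_card.
by [].
Qed.

Definition output_expr : expr R G := node_expr (root A).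

End NodeExpression.

Definition circuit_for (R : realType) (G : causal_graph)
    (M : set (model R G)) (X Y : {set var G}) (x : inst X) (y : inst Y)
    (A : circuit R G) : Prop :=
  forall m, M m -> eval m (output_expr A) = causal_effect m x y.

(* Main.v *)
(** Written out as a sum, over the instantiations compatible with [x] and [y],
    of products of parameters, the causal effect is itself the output of a
    circuit of depth two. Any circuit for the causal effect agrees with it on
    [M], so invariance of the output is identifiability. *)

Require Import Defs.
From mathcomp Require Import all_boot all_order all_algebra.
From mathcomp Require Import classical_sets reals.

Set Implicit Arguments.
Unset Strict Implicit.
Unset Printing Implicit Defensive.

Import Order.TTheory GRing.Theory Num.Theory.
Local Open Scope ring_scope.

(** Going once around a nonempty cycle through [u], the rank [f] increases strictly at each edge,
    which would give [f u < f u]. *)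
Lemma acyclic_rank (T : finType) (e : rel T) (f : T -> nat) :
  (forall u v, e u v -> f u < f v)%N -> acyclic e.
Proof.
move=> ef [//|u c]; rewrite /cycle => pc; exfalso.
have : path (relpre f ltn) u (rcons c u) by apply: sub_path pc.
rewrite path_sortedE; last by move=> ? ? ?; apply: ltn_trans.
by rewrite all_rcons /= ltnn.
Qed.

Lemma eval_node_expr (R : realType) (G : causal_graph) (A : circuit R G)
    (m : model R G) (n : node A) :
  eval m (node_expr n) =
  match node_label n with
  | LAdd => \sum_(n' | child n n') eval m (node_expr n')
  | LMul => \prod_(n' | child n n') eval m (node_expr n')
  | LConst c => c
  | LParam w p s => theta m p s
  end.
Proof.
by rewrite node_exprE; case: (node_label n) => //=; rewrite !big_map -big_enum.
Qed.

Section SumProdCircuit.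
Variables (R : realType) (G : causal_graph) (I J : finType).
Variables (w : I -> J -> var G) (p : forall i j, inst (pa (w i j))).
Variable s : forall i j, state (w i j).

(* [None] is the root, [Some (i, None)] the [i]-th product and
   [Some (i, Some j)] its [j]-th factor. *)
Let sp_node : finType := option (I * option J).

Let sp_child (n n' : sp_node) : bool :=
  match n, n' with
  | None, Some (_, None) => true
  | Some (i, None), Some (i', Some _) => i == i'
  | _, _ => false
  end.

(* An operation without operands has to be a leaf carrying its value. *)
Let sp_label (n : sp_node) : label R G :=
  match n with
  | None => if [exists i : I, true] then LAdd else LConst 0
  | Some (_, None) => if [exists j : J, true] then LMul else LConst 1
  | Some (i, Some j) => LParam (p i j) (s i j)
  end.

Let sp_acyclic : acyclic sp_child.
Proof.
(* The rank is the depth below the root. *)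
pose f (n : sp_node) :=
  match n with None => 0 | Some (_, None) => 1 | _ => 2 end%N.
by apply: (@acyclic_rank _ _ f) => [[[? [?|]]|]] [[? [?|]]|].
Qed.

Let sp_connect (n : sp_node) : connect sp_child None n.
Proof.
have c1 i : connect sp_child None (Some (i, None)) by apply: connect1.
case: n => [[i [j|]]|] //.
by apply: connect_trans (c1 i) _; apply: connect1 => /=.
Qed.

Let sp_internal (n : sp_node) :
  [exists n' : sp_node, sp_child n n'] = is_op (sp_label n).
Proof.
case: n => [[i [j|]]|] /=.
- by apply/existsP => -[? //].
(* Whichever branch the label takes, [is_op] of it has the truth value of the test, here that [J] is
   inhabited. *)
- rewrite [RHS](_ : _ = [exists j : J, true]); last by case: ifP.
  apply/existsP/existsP => [[[[i' [j|]]|] //=]|[j _]].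
  by exists (Some (i, Some j)) => /=.
- rewrite [RHS](_ : _ = [exists i : I, true]); last by case: ifP.
  apply/existsP/existsP => [[[[i' [j|]]|] //=]|[i' _]].
  by exists (Some (i', None)).
Qed.

Definition sum_prod_circuit : circuit R G :=
  Circuit sp_acyclic sp_connect sp_internal.

Lemma eval_sum_prod_circuit (m : model R G) :
  eval m (output_expr sum_prod_circuit) =
  \sum_i \prod_j theta m (p i j) (s i j).
Proof.
have prodE i : eval m (@node_expr _ _ sum_prod_circuit (Some (i, None))) =
    \prod_j theta m (p i j) (s i j).
  rewrite eval_node_expr /=; case: existsP => [_|nJ]; last first.
    by rewrite big1 // => j; case: nJ; exists j.
  (* [h'] forgets [i], yet it inverts the embedding of [J] on the children of [Some (i, None)],
     since an edge into a factor forces equal first components. *)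
  pose h' (n : sp_node) := if n is Some (_, Some j) then Some j else None.
  rewrite (@reindex_omap _ _ _ _ _ (fun j => Some (i, Some j)) h') /=.
    apply: eq_big => [j|j _]; first by rewrite !eqxx.
    by rewrite eval_node_expr.
  by case=> [[i' [j|]]|] //= /eqP <-.
rewrite /output_expr eval_node_expr /=; case: existsP => [_|nI]; last first.
  by rewrite big1 // => i; case: nI; exists i.
pose h' (n : sp_node) := if n is Some (i, None) then Some i else None.
rewrite (@reindex_omap _ _ _ _ _ (fun i => Some (i, None)) h') /=.
  by apply: eq_big => [i|i _]; rewrite ?eqxx ?prodE.
by case=> [[i [j|]]|].
Qed.

End SumProdCircuit.

(** Neither index type refers to the parameters, so one circuit serves all models. Both may be
    empty: [I] when [x] and [y] conflict on a common variable, [J] when [X] contains every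
    variable. *)
Lemma causal_effect_circuit (R : realType) (G : causal_graph)
    (M : set (model R G)) (X Y : {set var G}) (x : inst X) (y : inst Y) :
  exists A : circuit R G, circuit_for M x y A.
Proof.
pose A : {pred {dffun forall v : var G, state v}} :=
  [pred z | (restr X z == x) && (restr Y z == y)].
pose B : {pred var G} := [pred w | w \notin X].
(* The circuit ranges over whole types, so both filters become subtypes; [big_sub] converts back. *)
pose I : finType := {z in A}.
pose J : finType := {w in B}.
exists (@sum_prod_circuit R G I J (fun _ => val)
  (fun z w => restr (pa (val w)) (val z)) (fun z w => (val z) (val w))).
move=> m _; rewrite eval_sum_prod_circuit /causal_effect.
rewrite -(big_sub A (fun z => \prod_(w : J)
  theta m (restr (pa (val w)) z) (z (val w)))) /=.
apply: eq_bigr => z _.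
by rewrite -(big_sub B (fun w => theta m (restr (pa w) z) (z w))).
Qed.

Theorem proposition3 (R : realType) (G : causal_graph) (V : {set var G})
    (M : set (model R G)) (X Y : {set var G}) (x : inst X) (y : inst Y) :
  identifiable V M x y <->
  exists A : circuit R G,
    circuit_for M x y A /\ expr_invariant V M (output_expr A).
Proof.
split=> [idM|[A [AE Ainv]] m1 m2 M1 M2 m12]; last first.
  by rewrite -(AE m1 M1) -(AE m2 M2); apply: Ainv.
have [A AE] := causal_effect_circuit M x y.
by exists A; split=> // m1 m2 M1 M2 m12; rewrite !AE //; apply: idM.
Qed.
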